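(* Let $N$ and $N'$ be any two nilmanifolds of Heisenberg type (without restriction on the dimensions of the centers). If $N$ and $N'$ are not locally isometric, then they are not curvature equivalent.
   Context: Nilmanifolds of Heisenberg type. Let $m,r\ge1$ and let $\mathfrak v=\mathbb R^m$, $\mathfrak z=\mathbb R^r$ carry the standard inner products. Given a linear map $j:\mathfrak z\to\mathfrak{so}(\mathfrak v)$, $Z\mapsto j_Z$, let $\mathfrak g(j)$ be the two-step nilpotent metric Lie algebra with underlying vector space $\mathfrak v\oplus\mathfrak z$, standard inner product, and bracket defined by: $\mathfrak z$ is central, $[\mathfrak v,\mathfrak v]\subseteq\mathfrak z$, and $\langle j_ZX,Y\rangle=\langle Z,[X,Y]\rangle$ for $X,Y\in\mathfrak v$, $Z\in\mathfrak z$. Let $G(j)$ be the simply connected Lie group with Lie algebra $\mathfrak g(j)$, endowed with the left invariant Riemannian metric $g(j)$ given by this inner product at the identity. The map $j$ is of Heisenberg type if $j_Z^2=-|Z|^2\,\mathrm{Id}_{\mathfrak v}$ for all $Z\in\mathfrak z$. A nilmanifold of Heisenberg type is a compact quotient $\Gamma\backslash G(j)$ of such a $G(j)$, with $j$ of Heisenberg type, by a cocompact discrete subgroup $\Gamma$, with the induced metric. Two locally homogeneous Riemannian manifolds $(M,g)$, $(M',g')$ are called curvature equivalent (of order zero) if for $p\in M$, $p'\in M'$ there exists a euclidean isometry $F:(T_pM,g_p)\to(T_{p'}M',g'_{p'})$ which intertwines the Riemannian curvature operators, that is, $F(R(X,Y)Z)=R(F(X),F(Y))F(Z)$ for all $X,Y,Z\in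 T_pM$. *)

(* Defs.v *)
From HB Require Import structures.
From mathcomp Require Import all_boot all_order all_algebra.
From mathcomp Require Import all_classical all_reals all_analysis.
Set Implicit Arguments.
Unset Strict Implicit.
Unset Printing Implicit Defensive.
Import Order.TTheory GRing.Theory Num.Theory.
Import numFieldNormedType.Exports.
Local Open Scope classical_set_scope.
Local Open Scope quotient_scope.
Local Open Scope ring_scope.

(** Points and tangent vectors are row vectors, so the differential of [f] at [x]
    is [u |-> u *m jacobian f x].  A Riemannian metric on an open subset of R^n
    is given by its Gram matrices [g x] in the coordinate frame. *)

Section LocalGeometry.
Variable R : realType.

Definition partial n (i : 'I_n) (f : 'rV[R]_n -> R) (x : 'rV[R]_n) : R :=
  'D_(delta_mx 0 i) f x.

(* For open [U]: all partial derivatives of order at most [k] exist and those of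
   order [k] are continuous on [U]. *)
Fixpoint Ck_on (k : nat) n (U : set 'rV[R]_n) (f : 'rV[R]_n -> R) : Prop :=
  if k is l.+1 then
    forall i : 'I_n,
      (forall x, U x -> derivable f x (delta_mx 0 i)) /\ Ck_on l U (partial i f)
  else forall x, U x -> {for x, continuous f}.

Definition smooth_on n p (U : set 'rV[R]_n) (f : 'rV[R]_n -> 'rV[R]_p) : Prop :=
  forall k i, Ck_on k U (fun x => f x 0 i).

Definition metric n := 'rV[R]_n -> 'M[R]_n.

Definition inner n (g : metric n) (x u v : 'rV[R]_n) : R :=
  (u *m g x *m v^T) 0 0.

(* [christoffel g i j k] is Gamma^k_(ij). *)
Definition christoffel n (g : metric n) (i j k : 'I_n) (x : 'rV[R]_n) : R :=
  2^-1 * \sum_(l < n) invmx (g x) k l *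
    (partial i (fun y => g y j l) x + partial j (fun y => g y i l) x
     - partial l (fun y => g y i j) x).

(* The component along the [l]-th coordinate field of
   R(d_i, d_j) d_k = D_i D_j d_k - D_j D_i d_k, D the Levi-Civita connection. *)
Definition curvature_coef n (g : metric n) (i j k l : 'I_n) (x : 'rV[R]_n) : R :=
  partial i (christoffel g j k l) x - partial j (christoffel g i k l) x
  + \sum_(a < n) (christoffel g j k a x * christoffel g i a l x
                  - christoffel g i k a x * christoffel g j a l x).

Definition curvature n (g : metric n) (x u v w : 'rV[R]_n) : 'rV[R]_n :=
  \row_l \sum_i \sum_j \sum_k
    u 0 i * v 0 j * w 0 k * curvature_coef g i j k l x.

Definition isometry_between n n' (g : metric n) (U : set 'rV[R]_n)
    (g' : metric n') (U' : set 'rV[R]_n') (f : 'rV[R]_n -> 'rV[R]_n') : Prop :=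
  [/\ smooth_on U f,
      exists h : 'rV[R]_n' -> 'rV[R]_n,
        [/\ smooth_on U' h,
            forall x, U x -> U' (f x) /\ h (f x) = x &
            forall y, U' y -> U (h y) /\ f (h y) = y] &
      forall x u v, U x ->
        inner g' (f x) (u *m jacobian f x) (v *m jacobian f x) = inner g x u v].

End LocalGeometry.

Definition dot (R : realType) n (u v : 'rV[R]_n) : R := \sum_i u 0 i * v 0 i.

(* A linear map z -> so(v); [j Z] acts on v by X |-> X *m j Z. *)
Record so_map (R : realType) (m r : nat) := SoMap {
  so_fun :> {linear 'rV[R]_r -> 'M[R]_m};
  so_skew : forall Z, (so_fun Z)^T = - so_fun Z }.

Definition heisenberg_map (R : realType) m r (j : so_map R m r) : Prop :=
  forall Z, j Z *m j Z = - (dot Z Z)%:M.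

Section NilGroup.
Variables (R : realType) (m r : nat) (j : so_map R m r).

Definition vbracket (X Y : 'rV[R]_m) : 'rV[R]_r :=
  \row_k dot (X *m j (delta_mx 0 k)) Y.

(* This identity characterizes the bracket of g(j). *)
Lemma vbracketP X Y Z : dot (X *m j Z) Y = dot Z (vbracket X Y).
Proof.
rewrite {1}(row_sum_delta Z) linear_sum mulmx_sumr /dot.
under eq_bigr do rewrite summxE mulr_suml.
rewrite exchange_big /=; apply: eq_bigr => k _.
rewrite mxE /dot mulr_sumr; apply: eq_bigr => i _.
by rewrite linearZ /= -scalemxAr mxE mulrA.
Qed.

(* g(j) = v (+) z is 'rV_(m + r), with v the first m coordinates. *)
Definition lie_bracket (x y : 'rV[R]_(m + r)) : 'rV[R]_(m + r) :=
  row_mx 0 (vbracket (lsubmx x) (lsubmx y)).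

(* G(j) in exponential coordinates: the underlying manifold is g(j) and the
   product is given by the Baker-Campbell-Hausdorff formula, which stops after
   the first bracket since g(j) is two-step nilpotent. *)
Definition nil_mul (x y : 'rV[R]_(m + r)) : 'rV[R]_(m + r) :=
  x + y + 2^-1 *: lie_bracket x y.

Definition nil_inv (x : 'rV[R]_(m + r)) : 'rV[R]_(m + r) := - x.

Lemma vbracketDl X X' Y : vbracket (X + X') Y = vbracket X Y + vbracket X' Y.
Proof.
apply/rowP => k; rewrite !mxE /dot -big_split; apply: eq_bigr => i _ /=.
by rewrite mulmxDl mxE mulrDl.
Qed.

Lemma vbracketDr X Y Y' : vbracket X (Y + Y') = vbracket X Y + vbracket X Y'.
Proof.
apply/rowP => k; rewrite !mxE /dot -big_split; apply: eq_bigr => i _ /=.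
by rewrite [(Y + Y') _ _]mxE mulrDr.
Qed.

Lemma vbracketNl X Y : vbracket (- X) Y = - vbracket X Y.
Proof.
apply/rowP => k; rewrite !mxE /dot -sumrN; apply: eq_bigr => i _.
by rewrite mulNmx mxE mulNr.
Qed.

Lemma dotE (X Y : 'rV[R]_m) : dot X Y = (X *m Y^T) 0 0.
Proof. by rewrite mxE; apply: eq_bigr => i _; rewrite mxE. Qed.

Lemma vbracketxx X : vbracket X X = 0.
Proof.
apply/rowP => k; rewrite !mxE.
set A := j _; have skA : A^T = - A by exact: so_skew.
suff : dot (X *m A) X = - dot (X *m A) X.
  by move/eqP; rewrite -addr_eq0 -mulr2n mulrn_eq0 => /eqP.
rewrite !dotE -[in LHS](trmxK (X *m A *m X^T)) [LHS]mxE trmx_mul trmxK trmx_mul.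
by rewrite skA mulmxA mulmxN mulNmx mxE.
Qed.

Lemma lsubmx_nil_mul x y : lsubmx (nil_mul x y) = lsubmx x + lsubmx y.
Proof. by rewrite /nil_mul !linearD linearZ /= row_mxKl scaler0 addr0. Qed.

Lemma nil_mulA : associative nil_mul.
Proof.
move=> x y z; rewrite {1 3}/nil_mul /lie_bracket !lsubmx_nil_mul.
rewrite vbracketDl vbracketDr /nil_mul /lie_bracket.
set xy := vbracket (lsubmx x) (lsubmx y); set xz := vbracket (lsubmx x) _.
set yz := vbracket _ _; rewrite -[0]addr0 -!add_row_mx !addr0 !scalerDr.
set a := _ *: row_mx 0 xy; set b := _ *: row_mx 0 yz.
set c := _ *: row_mx 0 xz; rewrite [c + b]addrC !addrA.
by rewrite [x + y + a + z]addrAC [x + y + z + b + a]addrAC.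
Qed.

Lemma nil_mul0x : left_id 0 nil_mul.
Proof.
move=> x; have v0 : vbracket 0 (lsubmx x) = 0.
  by apply: (addrI (vbracket 0 (lsubmx x))); rewrite -vbracketDl !addr0.
by rewrite /nil_mul /lie_bracket linear0 v0 row_mx0 scaler0 addr0 add0r.
Qed.

Lemma nil_mulVx : left_inverse 0 nil_inv nil_mul.
Proof.
move=> x; rewrite /nil_mul /nil_inv /lie_bracket linearN /= vbracketNl vbracketxx.
by rewrite oppr0 row_mx0 scaler0 addr0 addNr.
Qed.

(* <u, v>_x is the standard inner product of the images of u and v under the
   differential at x of the left translation taking x to the identity. *)
Definition left_metric : metric R (m + r) := fun x =>
  let L := jacobian (nil_mul (nil_inv x)) x in L *m L^T.

Record nil_subgroup := NilSubgroup {
  subgroup_set :> set 'rV[R]_(m + r);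
  subgroup1 : subgroup_set 0;
  subgroupM : forall x y, subgroup_set x -> subgroup_set y ->
    subgroup_set (nil_mul x y);
  subgroupV : forall x, subgroup_set x -> subgroup_set (nil_inv x) }.

Section Cosets.
Variable Gamma : nil_subgroup.

(* Gamma acts by left translations: the points are the cosets [Gamma x]. *)
Definition same_coset (x y : 'rV[R]_(m + r)) : bool :=
  `[< exists2 a, subgroup_set Gamma a & y = nil_mul a x >].

Lemma same_coset_equiv : equiv_class_of same_coset.
Proof.
split.
- by move=> x; apply/asboolP; exists 0; [exact: subgroup1|rewrite nil_mul0x].
- have sym x y : same_coset x y -> same_coset y x.
    move=> /asboolP[a Ga ->]; apply/asboolP.
    exists (nil_inv a); first exact: subgroupV.
    by rewrite nil_mulA nil_mulVx nil_mul0x.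
  by move=> x y; apply/idP/idP; exact: sym.
- move=> y x z /asboolP[a Ga ->] /asboolP[b Gb ->]; apply/asboolP.
  by exists (nil_mul b a); [exact: subgroupM|rewrite nil_mulA].
Qed.

Canonical same_coset_rel := EquivRelPack same_coset_equiv.

Definition coset_space := quotient_topology {eq_quot same_coset_rel}.

Definition coset_proj (x : 'rV[R]_(m + r)) : coset_space := \pi x.

(* [coset_proj] restricted to such a set [U] is a homeomorphism onto an open
   subset of the quotient; for discrete Gamma these sets cover G(j), and the
   inverses are the charts of the quotient manifold, in which the induced metric
   is [left_metric]. *)
Definition chart_domain (U : set 'rV[R]_(m + r)) : Prop :=
  open U /\ set_inj U coset_proj.

End Cosets.
End NilGroup.

Record nilmanifold (R : realType) := Nilmanifold {
  dimv : nat;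
  dimz : nat;
  dimv_gt0 : (0 < dimv)%N;
  dimz_gt0 : (0 < dimz)%N;
  nil_map : so_map R dimv dimz;
  nil_gamma : nil_subgroup nil_map;
  nil_discrete : forall a, subgroup_set nil_gamma a -> isolated nil_gamma a;
  nil_cocompact : compact [set: coset_space nil_gamma] }.

Definition heisenberg_type (R : realType) (N : nilmanifold R) : Prop :=
  heisenberg_map (nil_map N).

Section Comparison.
Variable R : realType.
Implicit Types N : nilmanifold R.

Definition nil_proj N (x : 'rV[R]_(dimv N + dimz N)) :
    coset_space (nil_gamma N) := coset_proj (nil_gamma N) x.
Arguments nil_proj : clear implicits.

Definition nil_metric N : metric R (dimv N + dimz N) := left_metric (nil_map N).
Arguments nil_metric : clear implicits.

(* Every point of N has an open neighbourhood isometric to an open subset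
   of N'. *)
Definition locally_isometric_to N N' : Prop :=
  forall p : coset_space (nil_gamma N),
  exists (U : set 'rV[R]_(dimv N + dimz N)) (U' : set 'rV[R]_(dimv N' + dimz N'))
         (f : 'rV[R]_(dimv N + dimz N) -> 'rV[R]_(dimv N' + dimz N')),
    [/\ chart_domain (nil_gamma N) U, chart_domain (nil_gamma N') U',
        exists2 x, U x & nil_proj N x = p &
        isometry_between (nil_metric N) U (nil_metric N') U' f].

Definition locally_isometric N N' : Prop :=
  locally_isometric_to N N' /\ locally_isometric_to N' N.

(* For p the coset of x, T_pN is identified with the tangent space of G(j)
   at x by the differential of the projection, a local isometry. *)
Definition curvature_equivalent N N' : Prop :=
  forall (p : coset_space (nil_gamma N)) (p' : coset_space (nil_gamma N')),
  exists x x', [/\ nil_proj N x = p, nil_proj N' x' = p' &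
  exists F : {linear 'rV[R]_(dimv N + dimz N) -> 'rV[R]_(dimv N' + dimz N')},
    [/\ bijective F,
        forall u v, inner (nil_metric N') x' (F u) (F v)
                    = inner (nil_metric N) x u v &
        forall u v w, F (curvature (nil_metric N) x u v w)
                      = curvature (nil_metric N') x' (F u) (F v) (F w)]].

End Comparison.

Arguments nil_proj [R] N x.
Arguments nil_metric [R] N x.

(* Main.v *)
Require Import Defs.
From mathcomp Require Import all_boot all_order all_algebra.
From mathcomp Require Import all_classical all_reals all_analysis.
From mathcomp Require Import ring lra.
Set Implicit Arguments.
Unset Strict Implicit.
Unset Printing Implicit Defensive.
Import Order.TTheory GRing.Theory Num.Theory.
Import numFieldNormedType.Exports.
Local Open Scope classical_set_scope.
Local Open Scope ring_scope.

(** The contrapositive is proved: a curvature preserving isometry F between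
    tangent spaces forces the maps [j] and [j'] to be equivalent, in the sense
    that [A j' (Z B) = j Z A] for isometries A of the v parts and B of the z
    parts.  The isometry [A (+) B] of the Lie algebras is then an isomorphism,
    and composing it with left translations gives the local isometries
    ([left_metric_isometry]).

    Transported to the identity by left translations, the curvature is a
    trilinear expression [curv] in [j] and the bracket
    ([curvature_left_metric]).  Its Ricci form is [- r / 2] on v and [m / 4] on
    z ([ricciE]); the signs differ, so F has to preserve the decomposition
    ([curv_isometry_block]), with components A and B.  After conjugating [j']
    by A and B both maps live on the same spaces, and equality of the curvature
    tensors says two things:
    - from R(Z, W)X, the commutators of [j Z] and [j W] agree with those of
      [j' Z] and [j' W]; as the anticommutators agree too, [j Z j W = j' Z j' W];
    - from R(X, Y)Y, which is 3/4 of the image of Y under [j [X, Y]], each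
      [X j' Z] is of the form [X j W], with W depending on X and Z.
    The first statement alone does not suffice: when [r = 3 mod 4] it cannot see
    the multiplicities of the two irreducible Clifford modules.

    The two statements together make [j] and [j'] equivalent up to sign
    ([heis_pair_equiv]).  Fix a unit vector e.  The first statement gives
    [j' Z = j Z T = T^t j Z] with the orthogonal [T = - j e j' e], whence
    [(1 + T) j' Z = j Z (1 + T)], and [Q = T + T^t] commutes with all [j Z].
    The second statement gives
    [X Q = c X + X M] with c a scalar and [M = j e j U] for some U orthogonal
    to e.  Such an M is skew and commutes with the symmetric Q, so X M is
    orthogonal to both X and X Q, hence zero.  Every X is thus an eigenvector
    of Q, and Q is a scalar c.  Now (1 + T)(1 + T)^t = 2 + c: if this is nonzero,
    a multiple of 1 + T is an orthogonal intertwiner of [j] and [j'], and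
    otherwise [T = - 1] and [j' = - j]. *)

(** * The standard inner product *)

Section Dot.
Variable R : realType.

Lemma dotC n (u v : 'rV[R]_n) : dot u v = dot v u.
Proof. by apply: eq_bigr => i _; rewrite mulrC. Qed.

Lemma dotDl n (u v w : 'rV[R]_n) : dot (u + v) w = dot u w + dot v w.
Proof. by rewrite !dotE mulmxDl mxE. Qed.

Lemma dotZl n a (u v : 'rV[R]_n) : dot (a *: u) v = a * dot u v.
Proof. by rewrite !dotE -scalemxAl mxE. Qed.

Lemma dotNl n (u v : 'rV[R]_n) : dot (- u) v = - dot u v.
Proof. by rewrite -scaleN1r dotZl mulN1r. Qed.

Lemma dot0l n (u : 'rV[R]_n) : dot 0 u = 0.
Proof. by rewrite dotE mul0mx mxE. Qed.

Lemma dotDr n (u v w : 'rV[R]_n) : dot w (u + v) = dot w u + dot w v.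
Proof. by rewrite dotC dotDl !(dotC w). Qed.

Lemma dotZr n a (u v : 'rV[R]_n) : dot u (a *: v) = a * dot u v.
Proof. by rewrite dotC dotZl dotC. Qed.

Lemma dotNr n (u v : 'rV[R]_n) : dot u (- v) = - dot u v.
Proof. by rewrite dotC dotNl dotC. Qed.

Lemma dot0r n (u : 'rV[R]_n) : dot u 0 = 0.
Proof. by rewrite dotC dot0l. Qed.

Lemma dot_mulmxl n p (u : 'rV[R]_n) (M : 'M[R]_(n, p)) v :
  dot (u *m M) v = dot u (v *m M^T).
Proof. by rewrite !dotE trmx_mul trmxK mulmxA. Qed.

Lemma dot_delta n (u : 'rV[R]_n) k : dot u (delta_mx 0 k) = u 0 k.
Proof.
rewrite /dot (bigD1 k) //= big1 => [|i /negPf ik]; rewrite !mxE !eqxx ?ik /=.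
  by rewrite mulr1 addr0.
by rewrite mulr0.
Qed.

Lemma dot_row_mx n p (u u' : 'rV[R]_n) (v v' : 'rV[R]_p) :
  dot (row_mx u v) (row_mx u' v') = dot u u' + dot v v'.
Proof. by rewrite !dotE tr_row_mx mul_row_col mxE. Qed.

Lemma dot_self_eq0 n (u : 'rV[R]_n) : dot u u = 0 -> u = 0.
Proof.
move=> /eqP; rewrite psumr_eq0 => [/allP u0|i _]; last by rewrite -expr2 sqr_ge0.
apply/rowP => i; rewrite mxE; apply/eqP.
by have := u0 i (mem_index_enum i); rewrite mulf_eq0 orbb.
Qed.

Lemma dot_inj n (u v : 'rV[R]_n) : (forall w, dot u w = dot v w) -> u = v.
Proof. by move=> uv; apply/rowP => k; rewrite -!dot_delta. Qed.

Lemma dot_isometry n p (P : 'M[R]_(n, p)) : P *m P^T = 1%:M ->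
  forall u v, dot (u *m P) (v *m P) = dot u v.
Proof. by move=> PP u v; rewrite dot_mulmxl -mulmxA PP mulmx1. Qed.

End Dot.

(** * Equivalence of two maps of Heisenberg type *)

Section CliffordPair.
Variables (R : realType) (m r : nat).

Section One.
Variable j : {linear 'rV[R]_r -> 'M[R]_m}.
Hypothesis skew : forall Z, (j Z)^T = - j Z.
Hypothesis heis : forall Z, j Z *m j Z = - (dot Z Z)%:M.

Lemma heis_polar Z W : j Z *m j W + j W *m j Z = - (2 * dot Z W)%:M.
Proof.
have := heis (Z + W); rewrite linearD mulmxDl !mulmxDr !heis.
rewrite !dotDl !dotDr (dotC W Z).
move: (j Z *m j W) (j W *m j Z) => A B /matrixP E.
apply/matrixP => a b; have := E a b; rewrite !mxE.
by case: (a == b); rewrite /= ?mulr1n ?mulr0n; lra.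
Qed.

Lemma heis_dot Z X Y : dot (X *m j Z) (Y *m j Z) = dot Z Z * dot X Y.
Proof.
rewrite dot_mulmxl skew mulmxN -mulmxA heis mulmxN opprK.
by rewrite mul_mx_scalar dotZr.
Qed.

Lemma heis_dot_polar Z W X : dot (X *m j Z) (X *m j W) = dot Z W * dot X X.
Proof.
have E1 : dot (X *m j Z) (X *m j W) = - dot X (X *m (j W *m j Z)).
  by rewrite dot_mulmxl skew mulmxN dotNr mulmxA.
have E2 : dot (X *m j Z) (X *m j W) = - dot X (X *m (j Z *m j W)).
  by rewrite dotC dot_mulmxl skew mulmxN dotNr mulmxA.
have : dot (X *m j Z) (X *m j W) + dot (X *m j Z) (X *m j W) =
    2 * dot Z W * dot X X.
  rewrite {1}E1 E2 -opprD -dotDr -mulmxDr addrC heis_polar.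
  by rewrite mulmxN mul_mx_scalar dotNr opprK dotZr.
lra.
Qed.

End One.

Lemma scalar_of_eigen n (Q : 'M[R]_n) :
  (forall X : 'rV_n, exists c, X *m Q = c *: X) -> exists c, Q = c%:M.
Proof.
case: n Q => [|n] Q H; first by exists 0; apply/matrixP => -[].
have off i k : i != k -> Q i k = 0.
  move=> /negPf ik; have [a] := H (delta_mx 0 i).
  rewrite -rowE => /matrixP/(_ 0 k); rewrite !mxE eqxx /= eq_sym ik => ->.
  by rewrite mulr0.
exists (Q 0 0); apply/matrixP => i k; rewrite !mxE.
have [<-|/off//] := eqVneq i k; rewrite mulr1n.
have [->//|i0] := eqVneq i 0.
have [c] := H (delta_mx 0 i + delta_mx 0 0).
rewrite mulmxDl -!rowE => /matrixP E.
have := E 0 i; have := E 0 0; rewrite !mxE !eqxx /= (eq_sym 0) (negPf i0) /=.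
by rewrite (off _ _ i0) [Q 0 i]off 1?eq_sym // !add0r !addr0 => -> ->.
Qed.

Variables j j' : {linear 'rV[R]_r -> 'M[R]_m}.
Hypothesis skew : forall Z, (j Z)^T = - j Z.
Hypothesis skew' : forall Z, (j' Z)^T = - j' Z.
Hypothesis heis : forall Z, j Z *m j Z = - (dot Z Z)%:M.
Hypothesis heis' : forall Z, j' Z *m j' Z = - (dot Z Z)%:M.
Hypothesis comm_eq : forall Z W,
  j Z *m j W - j W *m j Z = j' Z *m j' W - j' W *m j' Z.

(** Commutators agree by hypothesis, anticommutators because both maps are of
    Heisenberg type. *)
Lemma heis_mul_eq Z W : j Z *m j W = j' Z *m j' W.
Proof.
have E : j Z *m j W + j W *m j Z = j' Z *m j' W + j' W *m j' Z.
  by rewrite !heis_polar.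
move: E (comm_eq Z W).
move: (j Z *m j W) (j W *m j Z) (j' Z *m j' W) (j' W *m j' Z) => A B A' B'.
move=> /matrixP E /matrixP E'; apply/matrixP => a b.
by have := E a b; have := E' a b; rewrite !mxE; lra.
Qed.

Hypothesis range_le : forall (X : 'rV_m) Z, exists W, X *m j' Z = X *m j W.

Hypothesis m_gt0 : (0 < m)%N.
Variable e : 'rV[R]_r.
Hypothesis e1 : dot e e = 1.

Let J := j e.
Let J' := j' e.
Let T := - (J *m J').
Let Q := T + T^T.

Let JJ : J *m J = - 1%:M. Proof. by rewrite heis e1. Qed.

Let JJ' : J' *m J' = - 1%:M. Proof. by rewrite heis' e1. Qed.

Let trT : T^T = - (J' *m J).
Proof. by rewrite linearN /= trmx_mul skew skew' mulNmx mulmxN opprK. Qed.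

Let jT Z : j' Z = j Z *m T.
Proof.
by rewrite mulmxN mulmxA (heis_mul_eq Z e) -mulmxA JJ' mulmxN opprK mulmx1.
Qed.

Let Tj Z : j' Z = T^T *m j Z.
Proof.
by rewrite trT mulNmx -mulmxA (heis_mul_eq e Z) mulmxA JJ' mulNmx opprK mul1mx.
Qed.

Let TTt : T *m T^T = 1%:M.
Proof.
rewrite trT mulmxN mulNmx opprK mulmxA -[J *m J' *m J']mulmxA JJ' mulmxN mulmx1.
by rewrite mulNmx JJ opprK.
Qed.

Let Tj' Z : T *m j' Z = j Z.
Proof. by rewrite Tj mulmxA TTt mul1mx. Qed.

Let Qj Z : Q *m j Z = j Z *m Q.
Proof.
have E : T *m j Z = j Z *m T^T by rewrite -[in RHS]Tj' jT -!mulmxA TTt mulmx1.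
by rewrite mulmxDl mulmxDr -Tj -jT E addrC.
Qed.

(** The range hypothesis at [X J] and at [X] expresses [X T] and [X T^T], hence
    [X Q], as a multiple of [X] plus [X M], where [M] is skew and commutes with
    the symmetric [Q].  Then [X M] is orthogonal to [X] since [M] is skew, and to
    [X Q] since [Q M] is skew, so it is orthogonal to itself. *)
Let Q_eigen (X : 'rV_m) : exists c, X *m Q = c *: X.
Proof.
have [W1 E1] := range_le (X *m J) e; have [W2 E2] := range_le X e.
(* The component of W along e only contributes a multiple of X, since J squares
   to -1; the rest U is orthogonal to e, so that J and j U anticommute. *)
set W := W2 - W1; set U := W - dot W e *: e.
have Ue : dot U e = 0 by rewrite dotDl dotNl dotZl e1 mulr1 subrr.
set M := J *m j U.
have E : X *m Q = (2 * dot W2 e - dot W e) *: X + X *m M.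
  have -> : X *m M = X *m J *m j W + dot W e *: X.
    rewrite /M /U linearB linearZ /= mulmxBr -scalemxAr JJ mulmxBr mulmxA.
    by rewrite -scalemxAr mulmxN mulmx1 scalerN opprK.
  have -> : X *m Q = X *m J *m j W2 + (2 * dot W2 e) *: X - X *m J *m j W1.
    rewrite mulmxDr trT !mulmxN !mulmxA E1 E2 addrC; congr (_ - _).
    have /eqP := heis_polar heis W2 e; rewrite addrC -[X in X + _]opprK addrC.
    rewrite subr_eq => /eqP H.
    by rewrite -!mulmxA H mulmxDr !mulmxN mul_mx_scalar opprD !opprK addrC.
  have -> : X *m J *m j W = X *m J *m j W2 - X *m J *m j W1.
    by rewrite /W linearB mulmxBr.
  move: (X *m J *m j W1) (X *m J *m j W2) (dot W e) => V1 V2 w.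
  by apply/rowP => k; rewrite !mxE; ring.
have Mskew : M^T = - M.
  rewrite trmx_mul !skew mulNmx mulmxN opprK.
  have := heis_polar heis U e; rewrite Ue mulr0 raddf0 oppr0 => /eqP.
  by rewrite addr_eq0 => /eqP.
have QM : Q *m M = M *m Q.
  by rewrite /M mulmxA (Qj e) -[LHS]mulmxA (Qj U) mulmxA.
have XM : dot X (X *m M) = 0.
  have : dot X (X *m M) = - dot X (X *m M).
    by rewrite [LHS]dotC dot_mulmxl Mskew mulmxN dotNr.
  lra.
have trQ : Q^T = Q by rewrite linearD /= trmxK addrC.
have QXM : dot (X *m Q) (X *m M) = 0.
  have : dot (X *m Q) (X *m M) = - dot (X *m Q) (X *m M).
    rewrite [LHS]dotC dot_mulmxl Mskew mulmxN dotNr -mulmxA QM mulmxA.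
    by rewrite dotC dot_mulmxl trQ dotC.
  lra.
exists (2 * dot W2 e - dot W e); rewrite E (_ : X *m M = 0) ?addr0 //.
apply: dot_self_eq0; rewrite -{1}[X *m M](addKr ((2 * dot W2 e - dot W e) *: X)).
by rewrite -E dotDl dotNl dotZl XM QXM mulr0 oppr0 addr0.
Qed.

(** [1 + T] intertwines [j'] and [j], and is a multiple of an isometry because
    [T + T^T] is a scalar.  It vanishes exactly when [j' = - j], which is the case
    [s = -1]. *)
Lemma heis_pair_equiv : exists S : 'M[R]_m, exists s : R,
  [/\ S *m S^T = 1%:M, s * s = 1 & forall Z, S *m j' Z = s *: (j Z *m S)].
Proof.
have [c Qc] := scalar_of_eigen Q_eigen.
pose P : 'M[R]_m := 1%:M + T.
have PPt : P *m P^T = (2 + c)%:M.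
  rewrite linearD /= trmx1 mulmxDl mul1mx mulmxDr mulmx1 TTt.
  move: Qc; rewrite /Q; move: T^T => Tt /matrixP Qc; apply/matrixP => a b.
  by have := Qc a b; rewrite !mxE; case: (a == b);
    rewrite /= ?mulr1n ?mulr0n; lra.
have Pj Z : P *m j' Z = j Z *m P.
  by rewrite mulmxDl mulmxDr mul1mx mulmx1 Tj' -jT addrC.
have [c2|c2] := eqVneq (2 + c) 0.
  exists 1%:M, (-1); split; first by rewrite trmx1 mulmx1.
    by rewrite mulrNN mulr1.
  have TN : T = - 1%:M.
    apply/eqP; rewrite -addr_eq0 addrC; apply/eqP/row_matrixP => i.
    rewrite [RHS]linear0; apply: dot_self_eq0.
    rewrite !rowE -/P dot_mulmxl -mulmxA PPt c2.
    by rewrite mul_mx_scalar scale0r dot0r.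
  by move=> Z; rewrite mul1mx mulmx1 jT TN mulmxN mulmx1 scaleN1r.
have c_gt0 : 0 < 2 + c.
  rewrite lt_neqAle eq_sym c2 /=.
  have /matrixP/(_ (Ordinal m_gt0) (Ordinal m_gt0)) := PPt.
  rewrite [P^T]lock !mxE eqxx mulr1n -lock => <-; apply: sumr_ge0 => k _.
  by rewrite [P^T _ _]mxE -expr2 sqr_ge0.
exists ((Num.sqrt (2 + c))^-1 *: P), 1; split; last 2 first.
- by rewrite mulr1.
- by move=> Z; rewrite scale1r -scalemxAl Pj scalemxAr.
rewrite linearZ /= -scalemxAl -scalemxAr scalerA PPt -invfM -expr2.
by rewrite sqr_sqrtr ?ltW // scale_scalar_mx mulVf.
Qed.

End CliffordPair.

(** * Linear maps given by functions *)

Section LinearFunctions.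
Variable R : realType.

(** The predicate [linear f] is used for bare functions, because the maps below
    are multilinear and have to be regarded as linear in each argument in turn. *)

Lemma lin_add (U V : lmodType R) (f g : U -> V) :
  linear f -> linear g -> linear (fun u => f u + g u).
Proof. by move=> lf lg a u v; rewrite lf lg scalerDr addrACA. Qed.

Lemma lin_scale (U V : lmodType R) c (f : U -> V) :
  linear f -> linear (fun u => c *: f u).
Proof. by move=> lf a u v; rewrite lf scalerDr !scalerA mulrC. Qed.

Lemma lin_opp (U V : lmodType R) (f : U -> V) :
  linear f -> linear (fun u => - f u).
Proof. by move=> lf a u v; rewrite lf opprD scalerN. Qed.

Lemma lin_comp (U V W : lmodType R) (f : V -> W) (g : U -> V) :
  linear f -> linear g -> linear (fun u => f (g u)).
Proof. by move=> lf lg a u v; rewrite lg lf. Qed.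

Lemma lin_mulmxl (U : lmodType R) m n p (f : U -> 'M[R]_(m, n))
  (M : 'M[R]_(n, p)) : linear f -> linear (fun u => f u *m M).
Proof. by move=> lf a u v; rewrite lf mulmxDl scalemxAl. Qed.

Lemma lin_mulmxr (U : lmodType R) m n p (M : 'M[R]_(m, n))
  (f : U -> 'M[R]_(n, p)) : linear f -> linear (fun u => M *m f u).
Proof. by move=> lf a u v; rewrite lf mulmxDr scalemxAr. Qed.

Lemma lin_row_mx (U : lmodType R) n p (f : U -> 'rV[R]_n) (g : U -> 'rV[R]_p) :
  linear f -> linear g -> linear (fun u => row_mx (f u) (g u)).
Proof. by move=> lf lg a u v; rewrite lf lg scale_row_mx add_row_mx. Qed.

Lemma linE (U V : lmodType R) (f : {linear U -> V}) : linear f.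
Proof. exact: linearP. Qed.

Lemma lin0 (U V : lmodType R) (f : U -> V) : linear f -> f 0 = 0.
Proof.
by move=> /(_ (-1) 0 0); rewrite scaler0 addr0 scaleN1r addNr.
Qed.

Lemma linD (U V : lmodType R) (f : U -> V) : linear f -> {morph f : u v / u + v}.
Proof. by move=> lf u v; have := lf 1 u v; rewrite !scale1r. Qed.

Lemma linZ (U V : lmodType R) (f : U -> V) : linear f -> scalable f.
Proof. by move=> lf a u; have := lf a u 0; rewrite (lin0 lf) !addr0. Qed.

Lemma lin_sum (U V : lmodType R) (f : U -> V) I (s : seq I) (F : I -> U) :
  linear f -> f (\sum_(i <- s) F i) = \sum_(i <- s) f (F i).
Proof.
move=> lf; elim: s => [|i s IH]; first by rewrite !big_nil lin0.
by rewrite !big_cons linD ?IH.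
Qed.

Definition mx_of n p (f : 'rV[R]_n -> 'rV[R]_p) : 'M[R]_(n, p) :=
  \matrix_i f (delta_mx 0 i).

Lemma mx_ofE n p (f : 'rV[R]_n -> 'rV[R]_p) u : linear f -> u *m mx_of f = f u.
Proof.
move=> lf; rewrite [in RHS](row_sum_delta u) lin_sum // mulmx_sum_row.
by apply: eq_bigr => i _; rewrite linZ // rowK.
Qed.

Lemma mx_of_gram n p (f : 'rV[R]_n -> 'rV[R]_p) a b :
  (mx_of f *m (mx_of f)^T) a b = dot (f (delta_mx 0 a)) (f (delta_mx 0 b)).
Proof. by rewrite mxE; apply: eq_bigr => k _; rewrite !mxE. Qed.

Lemma trilinear_expand n p (f : 'rV[R]_n -> 'rV[R]_n -> 'rV[R]_n -> 'rV[R]_p) :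
  (forall v w, linear (fun u => f u v w)) ->
  (forall u w, linear (fun v => f u v w)) ->
  (forall u v, linear (f u v)) ->
  forall u v w, f u v w = \sum_i \sum_k \sum_l
    (u 0 i * v 0 k * w 0 l) *: f (delta_mx 0 i) (delta_mx 0 k) (delta_mx 0 l).
Proof.
move=> l1 l2 l3 u v w; rewrite {1}(row_sum_delta u).
rewrite (lin_sum _ _ (l1 v w)); apply: eq_bigr => i _; rewrite (linZ (l1 v w)).
rewrite {1}(row_sum_delta v) (lin_sum _ _ (l2 _ w)) scaler_sumr.
apply: eq_bigr => k _; rewrite (linZ (l2 _ w)).
rewrite {1}(row_sum_delta w) (lin_sum _ _ (l3 _ _)) !scaler_sumr.
by apply: eq_bigr => l _; rewrite (linZ (l3 _ _)) !scalerA.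
Qed.

End LinearFunctions.

Lemma vbracket_linl (R : realType) m r (j : so_map R m r) Y :
  linear (fun X => vbracket j X Y).
Proof.
move=> a X X'; rewrite vbracketDl; congr (_ + _); apply/rowP => k; rewrite !mxE.
by rewrite -scalemxAl dotZl.
Qed.

Lemma vbracket_linr (R : realType) m r (j : so_map R m r) X :
  linear (vbracket j X).
Proof.
move=> a Y Y'; rewrite vbracketDr; congr (_ + _); apply/rowP => k; rewrite !mxE.
by rewrite dotZr.
Qed.

Ltac lin_tac j := repeat first
  [ exact: linearP
  | apply: lin_scale | apply: lin_row_mx | apply: lin_add | apply: lin_opp
  | apply: lin_mulmxl
  | apply: lin_mulmxr
  | apply: (lin_comp (linE (so_fun j)))
  | apply: (lin_comp (f := vbracket j _)); first exact: vbracket_linr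
  | apply: (lin_comp (f := (vbracket j)^~ _)); first exact: vbracket_linl ].

(** * The curvature tensor of a two-step nilpotent metric Lie algebra *)

Section Curvature.
Variables (R : realType) (m r : nat) (j : so_map R m r).
Implicit Types (u v w : 'rV[R]_(m + r)) (X Y : 'rV[R]_m) (Z W : 'rV[R]_r).

(** The curvature R(u, v)w at the identity.  With [X, Y, V] and [A, B, C] the
    v and z parts of [u, v, w], operators are applied on the right, so that
    [V *m j B *m j A] is j_A (j_B V). *)
Definition curv u v w : 'rV[R]_(m + r) :=
  let X := lsubmx u in let Y := lsubmx v in let V := lsubmx w in
  let A := rsubmx u in let B := rsubmx v in let C := rsubmx w in
  4^-1 *: row_mx
    (Y *m j (vbracket j X V) - X *m j (vbracket j Y V)
     + 2 *: (V *m j (vbracket j X Y))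
     + (V *m j B *m j A - V *m j A *m j B)
     + (Y *m j C *m j A - X *m j C *m j B))
    (vbracket j Y (X *m j C + V *m j A) - vbracket j X (Y *m j C + V *m j B)).

Lemma curv_lin1 v w : linear (fun u => curv u v w).
Proof. by rewrite /curv; lin_tac j. Qed.

Lemma curv_lin2 u w : linear (fun v => curv u v w).
Proof. by rewrite /curv; lin_tac j. Qed.

Lemma curv_lin3 u v : linear (curv u v).
Proof. by rewrite /curv; lin_tac j. Qed.

Lemma dot_j Z X Y : dot (X *m j Z) Y = - dot X (Y *m j Z).
Proof. by rewrite dot_mulmxl so_skew mulmxN dotNr. Qed.

Lemma vbracketC X Y : vbracket j Y X = - vbracket j X Y.
Proof.
by apply: dot_inj => Z; rewrite dotNl !(dotC _ Z) -!vbracketP dot_j dotC.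
Qed.

Lemma vbracket0l Y : vbracket j 0 Y = 0.
Proof. exact: lin0 (vbracket_linl j Y). Qed.

Lemma vbracket0r X : vbracket j X 0 = 0.
Proof. exact: lin0 (vbracket_linr j X). Qed.

Lemma j0 : j 0 = 0.
Proof. exact: linear0. Qed.

Definition ricci v w : R :=
  \sum_i dot (curv (delta_mx 0 i) v w) (delta_mx 0 i).

Lemma curv_vv_dot X v w :
  dot (curv (row_mx X 0) v w) (row_mx X 0) =
  - (3 / 4) * dot (vbracket j X (lsubmx v)) (vbracket j X (lsubmx w))
  + 4^-1 * dot (X *m j (rsubmx w)) (X *m j (rsubmx v)).
Proof.
rewrite /curv !row_mxKl !row_mxKr dotZl dot_row_mx dot0r addr0.
rewrite j0 !mulmx0 !mul0mx subr0 addr0 sub0r.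
rewrite !dotDl !dotNl dotZl (dot_j (rsubmx v)) !vbracketP vbracketxx dot0r.
rewrite !(vbracketC X) !dotNr (dotC (vbracket j X (lsubmx w))).
by field.
Qed.

Lemma curv_zz_dot Z v w :
  dot (curv (row_mx 0 Z) v w) (row_mx 0 Z) =
  4^-1 * dot (lsubmx w *m j Z) (lsubmx v *m j Z).
Proof.
rewrite /curv !row_mxKl !row_mxKr dotZl dot_row_mx dot0r add0r.
rewrite !mul0mx add0r vbracket0l subr0 (dotC _ Z) -vbracketP.
by rewrite dotC.
Qed.

Hypothesis heis : heisenberg_map j.

Lemma sum_heis_dot X Y :
  \sum_k dot (X *m j (delta_mx 0 k)) (Y *m j (delta_mx 0 k)) = r%:R * dot X Y.
Proof.
under eq_bigr do
  rewrite (heis_dot (@so_skew _ _ _ j) heis) dot_delta mxE !eqxx mul1r.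
by rewrite sumr_const card_ord mulr_natl.
Qed.

Lemma sum_vbracket_dot X Y :
  \sum_i dot (vbracket j (delta_mx 0 i) X) (vbracket j (delta_mx 0 i) Y) =
  r%:R * dot X Y.
Proof.
have coord X' k i :
    vbracket j (delta_mx 0 i) X' 0 k = - (X' *m j (delta_mx 0 k)) 0 i.
  by rewrite mxE dot_j dotC dot_delta.
rewrite -sum_heis_dot exchange_big; apply: eq_bigr => k _.
by apply: eq_bigr => i _; rewrite !coord mulrNN.
Qed.

Lemma ricciE v w :
  ricci v w = - (r%:R / 2) * dot (lsubmx v) (lsubmx w)
              + (m%:R / 4) * dot (rsubmx v) (rsubmx w).
Proof.
rewrite /ricci big_split_ord /=.
under eq_bigr do rewrite delta_mx_lshift curv_vv_dot
  (heis_dot_polar (@so_skew _ _ _ j) heis) dot_delta mxE !eqxx mulr1.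
under [X in _ + X]eq_bigr do rewrite delta_mx_rshift curv_zz_dot.
rewrite big_split -!mulr_sumr sum_vbracket_dot sum_heis_dot sumr_const card_ord.
rewrite (dotC (rsubmx w)) (dotC (lsubmx w)) -mulr_natl /=.
by field.
Qed.

End Curvature.

Section CurvatureIsometry.
Variables (R : realType) (m r m' r' : nat).
Variables (j : so_map R m r) (j' : so_map R m' r').

Definition so_equiv : Prop := exists (A : 'M[R]_(m, m')) (B : 'M[R]_(r, r')),
  [/\ A *m A^T = 1%:M, A^T *m A = 1%:M, B *m B^T = 1%:M, B^T *m B = 1%:M &
      forall Z, A *m j' (Z *m B) = j Z *m A].

Hypotheses (m_gt0 : (0 < m)%N) (r_gt0 : (0 < r)%N) (m'_gt0 : (0 < m')%N)
  (r'_gt0 : (0 < r')%N).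
Hypotheses (heis : heisenberg_map j) (heis' : heisenberg_map j').

Variable P : 'M[R]_(m + r, m' + r').
Hypothesis PPt : P *m P^T = 1%:M.
Hypothesis PtP : P^T *m P = 1%:M.
Hypothesis curvP : forall u v w,
  curv j' (u *m P) (v *m P) (w *m P) = curv j u v w *m P.

(** Ricci curvature is a trace, and [P] conjugates the two operators whose traces
    are compared. *)
Lemma ricci_invariant v w : ricci j' (v *m P) (w *m P) = ricci j v w.
Proof.
have tr n (f : 'rV[R]_n -> 'rV[R]_n) :
    \sum_i dot (f (delta_mx 0 i)) (delta_mx 0 i) = \tr (mx_of f).
  by apply: eq_bigr => i _; rewrite dot_delta mxE.
rewrite /ricci (tr _ (fun u => curv j u v w)).
rewrite (tr _ (fun u => curv j' u (v *m P) (w *m P))).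
set M' := mx_of _; set M := mx_of _.
have PM : P *m M' = M *m P.
  apply/row_matrixP => i; rewrite !rowE !mulmxA !mx_ofE ?curvP //.
    exact: curv_lin1.
  exact: curv_lin1.
by rewrite -[M']mul1mx -PtP -mulmxA PM mulmxA mxtrace_mulC mulmxA PPt mul1mx.
Qed.

(** The Ricci operator, which [P] intertwines, is negative on v and positive on
    z.  Hence a vector of v cannot have a z component in its image, nor
    conversely. *)
Lemma curv_isometry_block : exists (A : 'M[R]_(m, m')) (B : 'M[R]_(r, r')),
  P = block_mx A 0 0 B.
Proof.
have key (v : 'rV_(m + r)) : row_mx (- (r'%:R / 2) *: lsubmx (v *m P))
                    ((m'%:R / 4) *: rsubmx (v *m P)) =
             row_mx (- (r%:R / 2) *: lsubmx v) ((m%:R / 4) *: rsubmx v) *m P.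
  apply: dot_inj => w; have -> : w = w *m P^T *m P by rewrite -mulmxA PtP mulmx1.
  move: (w *m P^T) => {}w; rewrite (dot_isometry PPt).
  rewrite -{1}(hsubmxK (w *m P)) -{3}(hsubmxK w) !dot_row_mx !dotZl.
  by rewrite -(ricciE heis') -(ricciE heis) ricci_invariant.
have gt0 (n k : nat) : (0 < n)%N -> (0 < k)%N -> n%:R / 2 + k%:R / 4 != 0 :> R.
  by move=> n0 k0; rewrite lt0r_neq0 // addr_gt0 // divr_gt0 ?ltr0n.
have ur0 : ursubmx P = 0.
  apply/row_matrixP => i; rewrite [RHS]linear0 rowE.
  have := key (row_mx (delta_mx 0 i) 0).
  rewrite row_mxKl row_mxKr -{1 2 3}(submxK P) !mul_row_block scaler0.
  rewrite !mul0mx !addr0 row_mxKl row_mxKr => /eq_row_mx[_] /eqP; rewrite -scalemxAl -subr_eq0.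
  rewrite -scalerBl opprK addrC scaler_eq0 (negPf (gt0 _ _ r_gt0 m'_gt0)).
  by move/eqP.
have dl0 : dlsubmx P = 0.
  apply/row_matrixP => i; rewrite [RHS]linear0 rowE.
  have := key (row_mx 0 (delta_mx 0 i)).
  rewrite row_mxKl row_mxKr -{1 2 3}(submxK P) !mul_row_block scaler0.
  rewrite !mul0mx !add0r row_mxKl row_mxKr => /eq_row_mx[/eqP + _]; rewrite -scalemxAl -subr_eq0.
  rewrite -scalerBl -opprD scaler_eq0 oppr_eq0 (negPf (gt0 _ _ r'_gt0 m_gt0)).
  by move/eqP.
by exists (ulsubmx P), (drsubmx P); rewrite -{1}(submxK P) ur0 dl0.
Qed.

(** The diagonal blocks of [P] satisfy the hypotheses of [heis_pair_equiv] for
    [j] and the conjugate [cj] of [j'].  The range condition comes from R(X, Y)Y: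
    any [Z] is, up to a nonzero factor, the bracket of [X j Z] with [X]. *)
Lemma curv_isometry_equiv : so_equiv.
Proof.
have [A [B PE]] := curv_isometry_block.
have [AAt BBt] : A *m A^T = 1%:M /\ B *m B^T = 1%:M.
  have := PPt; rewrite PE tr_block_mx mulmx_block !trmx0 !mulmx0 !mul0mx.
  by rewrite !addr0 !add0r scalar_mx_block => /eq_block_mx[-> _ _ ->].
have [AtA BtB] : A^T *m A = 1%:M /\ B^T *m B = 1%:M.
  have := PtP; rewrite PE tr_block_mx mulmx_block !trmx0 !mulmx0 !mul0mx.
  by rewrite !addr0 !add0r scalar_mx_block => /eq_block_mx[-> _ _ ->].
have vP (X : 'rV_m) : row_mx X 0 *m P = row_mx (X *m A) 0.
  by rewrite PE mul_row_block !mulmx0 mul0mx !addr0.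
have zP (Z : 'rV_r) : row_mx 0 Z *m P = row_mx 0 (Z *m B).
  by rewrite PE mul_row_block !mulmx0 mul0mx !add0r.
have n4 : 4^-1 != 0 :> R by rewrite invr_eq0 pnatr_eq0.
have curv_vvv X Y : Y *m A *m j' (vbracket j' (X *m A) (Y *m A)) =
                    Y *m j (vbracket j X Y) *m A.
  have := curvP (row_mx X 0) (row_mx Y 0) (row_mx Y 0).
  rewrite !vP /curv !row_mxKl !row_mxKr -scalemxAl => /(scalerI n4).
  rewrite !vbracketxx !j0 !mulmx0 ?mul0mx !subr0 !addr0.
  rewrite PE mul_row_block !mulmx0 !addr0 => /eq_row_mx[+ _].
  rewrite -{1}[_ *m j' _]scale1r -{1}[_ *m j (vbracket j X Y)]scale1r -!scalerDl.
  by rewrite -scalemxAl => /scalerI; apply; apply: lt0r_neq0; lra.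
have curv_zzv (X : 'rV_m) Z W :
    X *m A *m (j' (W *m B) *m j' (Z *m B) - j' (Z *m B) *m j' (W *m B)) =
    X *m (j W *m j Z - j Z *m j W) *m A.
  have := curvP (row_mx 0 Z) (row_mx 0 W) (row_mx X 0).
  rewrite !vP !zP /curv !row_mxKl !row_mxKr -scalemxAl => /(scalerI n4).
  rewrite !vbracket0l !j0 !mulmx0 !mul0mx !subr0 scaler0 !addr0 !add0r.
  rewrite PE mul_row_block !mulmx0 !addr0 => /eq_row_mx[+ _].
  by rewrite scaler0 add0r !mulmxBr !mulmxA !mulmxBl.
pose cj := [the {linear 'rV[R]_r -> 'M[R]_m} of
  mulmx A \o mulmxr A^T \o j' \o mulmxr B].
have cjE Z : cj Z = A *m (j' (Z *m B) *m A^T) by [].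
have cj_mul Z W : cj Z *m cj W = A *m (j' (Z *m B) *m j' (W *m B)) *m A^T.
  by rewrite !cjE !mulmxA -[_ *m A^T *m A]mulmxA AtA mulmx1.
have cj_skew Z : (cj Z)^T = - cj Z.
  by rewrite cjE !trmx_mul trmxK so_skew mulmxN mulNmx mulmxA.
have cj_heis Z : cj Z *m cj Z = - (dot Z Z)%:M.
  rewrite cj_mul heis' (dot_isometry BBt) mulmxN mulNmx.
  by rewrite mul_mx_scalar -scalemxAl AAt scalemx1.
have cj_comm Z W : j Z *m j W - j W *m j Z = cj Z *m cj W - cj W *m cj Z.
  apply/row_matrixP => i; rewrite !rowE !cj_mul -mulmxBl -mulmxBr !mulmxA.
  by rewrite curv_zzv -mulmxA AAt mulmx1.
have cj_range (X : 'rV_m) Z : exists W, X *m cj Z = X *m j W.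
  have [->|X0] := eqVneq X 0; first by exists 0; rewrite !mul0mx.
  have XX : dot X X != 0 by apply: contra_neq X0; exact: dot_self_eq0.
  exists (- (dot X X)^-1 *: vbracket j (X *m cj Z) X).
  have := curv_vvv (X *m cj Z) X.
  have -> : X *m cj Z *m A = X *m A *m j' (Z *m B).
    by rewrite cjE !mulmxA -mulmxA AtA mulmx1.
  have -> : vbracket j' (X *m A *m j' (Z *m B)) (X *m A) = - dot X X *: (Z *m B).
    apply: dot_inj => W; rewrite dotC -vbracketP dot_j.
    rewrite (heis_dot_polar (@so_skew _ _ _ j') heis') (dot_isometry AAt).
    by rewrite dotZl mulNr mulrC.
  rewrite linearZ -scalemxAr => /(congr1 (mulmx^~ A^T)).
  rewrite -mulmxA AAt mulmx1 linearZ -scalemxAr => <-.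
  by rewrite -scalemxAl scalerA mulrNN mulVf // scale1r cjE !mulmxA.
have [S [s [SSt ss SE]]] := heis_pair_equiv (@so_skew _ _ _ j) cj_skew heis
  cj_heis cj_comm cj_range m_gt0 (e := delta_mx 0 (Ordinal r_gt0))
  ltac:(by rewrite dot_delta mxE !eqxx).
exists (S *m A), (s *: B); split.
- by rewrite trmx_mul !mulmxA -[S *m A *m _]mulmxA AAt mulmx1.
- by rewrite trmx_mul !mulmxA -[A^T *m _ *m _]mulmxA (mulmx1C SSt) mulmx1.
- by rewrite linearZ -scalemxAl -scalemxAr scalerA ss scale1r.
- by rewrite -scalemxAr [(_ *: _)^T]linearZ /= -scalemxAl scalerA ss scale1r.
- move=> Z; rewrite -scalemxAr [j' _]linearZ -scalemxAr.
  have -> : S *m A *m j' (Z *m B) = S *m cj Z *m A.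
    by rewrite cjE -!mulmxA AtA mulmx1.
  by rewrite SE -scalemxAl scalerA ss scale1r mulmxA.
Qed.

End CurvatureIsometry.

Lemma so_equiv_sym (R : realType) m r m' r' (j : so_map R m r)
  (j' : so_map R m' r') : so_equiv j j' -> so_equiv j' j.
Proof.
move=> [A [B [AAt AtA BBt BtB E]]]; exists A^T, B^T; rewrite !trmxK; split=> // Z.
have := E (Z *m B^T); rewrite -mulmxA BtB mulmx1 => /(congr1 (mulmx A^T)).
by rewrite mulmxA AtA mul1mx => ->; rewrite -!mulmxA AAt mulmx1.
Qed.

Lemma so_equiv_vbracket (R : realType) m r m' r' (j : so_map R m r)
    (j' : so_map R m' r') (A : 'M[R]_(m, m')) (B : 'M[R]_(r, r')) X Y :
    A *m A^T = 1%:M -> B *m B^T = 1%:M -> B^T *m B = 1%:M ->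
    (forall Z, A *m j' (Z *m B) = j Z *m A) ->
  vbracket j' (X *m A) (Y *m A) = vbracket j X Y *m B.
Proof.
move=> AAt BBt BtB E; apply: dot_inj => W.
have -> : W = W *m B^T *m B by rewrite -mulmxA BtB mulmx1.
move: (W *m B^T) => {}W; rewrite (dot_isometry BBt) !(dotC _ W) dotC.
by rewrite -!vbracketP -mulmxA E mulmxA (dot_isometry AAt).
Qed.

(** * Affine and quadratic functions of several variables *)

Section Affine.
Variable R : realType.

(** All functions differentiated below are quadratic along lines, so that their
    directional derivatives are read off from an expansion in [h]. *)
Lemma is_derive_quadratic n (f : 'rV[R]_n -> R) x v (a b : R) :
  (forall h, f (h *: v + x) = f x + h * (a + h * b)) -> is_derive x v f a.
Proof.
move=> H.
have lim_a : (fun h => h^-1 *: ((f \o shift x) (h *: v) - f x)) @ 0^' --> a.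
  have E : {near 0^', (fun h : R => a + h * b) =1
      (fun h => h^-1 *: ((f \o shift x) (h *: v) - f x))}.
    near=> h; rewrite /= H [f x + _]addrC addrK /GRing.scale /= mulKf //.
    by near: h; exact: nbhs_dnbhs_neq.
  apply: cvg_trans (near_eq_cvg E) _ => {E}.
  have : (fun h : R => a + h * b) @ 0 --> a + 0 * b.
    by apply: cvgD; [exact: cvg_cst|apply: cvgM; [exact: cvg_id|exact: cvg_cst]].
  rewrite mul0r addr0; apply: cvg_trans; apply: cvg_app; exact: nbhs_dnbhs.
by split; [apply/cvg_ex; exists a|exact: cvg_lim].
Unshelve. all: by end_near. Qed.

Lemma mx_continuous_at (T : topologicalType) n p (f : T -> 'M[R]_(n, p)) x :
  (forall i k, {for x, continuous (fun y => f y i k)}) ->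
  {for x, continuous f}.
Proof.
move=> H; apply/cvg_ballP => e e0.
have : \forall y \near x, forall i k, ball (f x i k) e (f y i k).
  apply: filter_forall => i; apply: filter_forall => k.
  by have /cvg_ballP/(_ e e0) := H i k.
by apply: filterS => y Hy; split.
Qed.

Lemma dot_continuous_at (T : topologicalType) n (f g : T -> 'rV[R]_n) x :
  {for x, continuous f} -> {for x, continuous g} ->
  {for x, continuous (fun y => dot (f y) (g y))}.
Proof.
move=> cf cg; apply: cvg_big => [|i _]; first exact: add_continuous.
apply: cvgM.
  exact: cvg_comp cf (@coord_continuous R 1 n 0 i (f x)).
exact: cvg_comp cg (@coord_continuous R 1 n 0 i (g x)).
Qed.

Lemma mulmx_continuous_at (T : topologicalType) n p (f : T -> 'rV[R]_n)
    (M : 'M[R]_(n, p)) x :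
  {for x, continuous f} -> {for x, continuous (fun y => f y *m M)}.
Proof.
move=> cf; apply: mx_continuous_at => i k; rewrite ord1.
have -> : (fun y => (f y *m M) 0 k) = (fun y => dot (f y) (row k M^T)).
  by apply/funext => y; rewrite mxE; apply: eq_bigr => l _; rewrite !mxE.
apply: (dot_continuous_at (g := cst (row k M^T))); first exact: cf.
exact: cst_continuous.
Qed.

Lemma Ck_affine k n (U : set 'rV[R]_n) (a : R) b : Ck_on k U (fun y => a + dot y b).
Proof.
elim: k a b => [|k IH] a b.
  have H (x : 'rV[R]_n) : {for x, continuous (fun y => a + dot y b)}.
    apply: (continuousD (f := cst a) (g := fun y => dot y b)).
      exact: cst_continuous.
    apply: (dot_continuous_at (f := id) (g := cst b)); first exact: cvg_id.
    exact: cst_continuous.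
  by move=> x _; exact: H.
move=> i.
have D x : is_derive x (delta_mx 0 i) (fun y : 'rV_n => a + dot y b) (b 0 i).
  apply: (@is_derive_quadratic _ _ _ _ _ 0) => h.
  by rewrite dotDl dotZl (dotC _ b) dot_delta; ring.
split=> [x _|]; first exact: ex_derive.
have -> : partial i (fun y => a + dot y b) = fun y => b 0 i + dot y 0.
  by apply/funext => x; rewrite /partial derive_val dot0r addr0.
exact: IH.
Qed.

Lemma smooth_affine n p (U : set 'rV[R]_n) (c : 'rV[R]_p) (M : 'M[R]_(n, p)) :
  smooth_on U (fun y => c + y *m M).
Proof.
move=> k i; have -> : (fun x => (c + x *m M) 0 i) =
    (fun x => c 0 i + dot x (row i M^T)).
  apply/funext => x; rewrite !mxE; congr (_ + _).
  by apply: eq_bigr => l _; rewrite !mxE.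
exact: Ck_affine.
Qed.

Lemma affine_continuous n p (c : 'rV[R]_p) (M : 'M[R]_(n, p)) :
  continuous (fun y : 'rV[R]_n => c + y *m M).
Proof.
move=> x; apply: (continuousD (f := cst c) (g := mulmxr M)).
  exact: cst_continuous.
by apply: (mulmx_continuous_at (f := id)); exact: cvg_id.
Qed.

Lemma jacobian_affine n p (c : 'rV[R]_p) (M : 'M[R]_(n, p)) x :
  jacobian (fun y => c + y *m M) x = M.
Proof.
have cM : continuous (mulmxr M : 'rV[R]_n -> 'rV[R]_p).
  by move=> y; apply: mulmx_continuous_at; exact: cvg_id.
have D : is_diff x (mulmxr M : 'rV[R]_n -> 'rV[R]_p) (mulmxr M).
  by split; [exact: linear_differentiable|exact: diff_lin].
have : is_diff x (cst c + (mulmxr M : 'rV[R]_n -> 'rV[R]_p)) (0 + mulmxr M).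
  exact: is_diffD.
move=> [_ E]; apply/row_matrixP => i.
rewrite !rowE mul_rV_lin1.
rewrite (_ : (fun y => _) = cst c + (mulmxr M : 'rV[R]_n -> 'rV[R]_p)) // E.
by rewrite add0r.
Qed.

End Affine.

(** * Curvature of the left invariant metric *)

Section LeviCivita.
Variables (R : realType) (m r : nat) (j : so_map R m r).
Implicit Types (x y u v w p q : 'rV[R]_(m + r)).
Local Notation "[[ u , v ]]" := (lie_bracket j u v).

Lemma lie_linl v : linear (fun u => [[u, v]]).
Proof.
apply: lin_row_mx; first by move=> a u w; rewrite scaler0 addr0.
exact: (lin_comp (f := (vbracket j)^~ _)) (vbracket_linl _ _) (linE lsubmx).
Qed.

Lemma lie_linr u : linear (fun v => [[u, v]]).
Proof.
apply: lin_row_mx; first by move=> a v w; rewrite scaler0 addr0.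
exact: (lin_comp (f := vbracket j _)) (vbracket_linr _ _) (linE lsubmx).
Qed.

Lemma lieC u v : [[v, u]] = - [[u, v]].
Proof. by rewrite /lie_bracket vbracketC opp_row_mx oppr0. Qed.

Lemma lie_center u v w : [[u, [[v, w]]]] = 0.
Proof. by rewrite /lie_bracket row_mxKl vbracket0r row_mx0. Qed.

Lemma lie_centerl u v w : [[[[v, w]], u]] = 0.
Proof. by rewrite lieC lie_center oppr0. Qed.

(** The differential at [x] of the left translation taking [x] to the identity. *)
Definition theta x u := u - 2^-1 *: [[x, u]].

Lemma theta_lin x : linear (theta x).
Proof.
apply: lin_add (linE idfun) (lin_opp _).
exact: lin_scale (lie_linr x).
Qed.

Lemma lie_thetal x u v : [[theta x u, v]] = [[u, v]].
Proof.
rewrite /theta (linD (lie_linl _)) -scaleNr (linZ (lie_linl v)).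
by rewrite lie_centerl scaler0 addr0.
Qed.

Lemma lie_thetar x u v : [[u, theta x v]] = [[u, v]].
Proof. by rewrite [LHS]lieC lie_thetal -lieC. Qed.

Lemma theta_lie x u v : theta x [[u, v]] = [[u, v]].
Proof. by rewrite /theta lie_center scaler0 subr0. Qed.

Lemma theta_addl h v x u : theta (h *: v + x) u = theta x u - (h / 2) *: [[v, u]].
Proof.
rewrite /theta (linD (lie_linl u)) (linZ (lie_linl u)).
by apply/rowP => k; rewrite !mxE; field.
Qed.

Lemma theta_opp x u : theta (- x) u = u + 2^-1 *: [[x, u]].
Proof.
by rewrite /theta -[- x]scaleN1r (linZ (lie_linl u)) scaleN1r scalerN opprK.
Qed.

Lemma lieDr u v w : [[u, v + w]] = [[u, v]] + [[u, w]].
Proof. exact: linD (lie_linr u) _ _. Qed.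

Lemma lieZr a u v : [[u, a *: v]] = a *: [[u, v]].
Proof. exact: linZ (lie_linr u) _ _. Qed.

Lemma lieNl u v : [[- u, v]] = - [[u, v]].
Proof. by rewrite -[- u]scaleN1r (linZ (lie_linl v)) scaleN1r. Qed.

Lemma thetaD x u v : theta x (u + v) = theta x u + theta x v.
Proof. exact: linD (theta_lin x) _ _. Qed.

Lemma thetaZ a x u : theta x (a *: u) = a *: theta x u.
Proof. exact: linZ (theta_lin x) _ _. Qed.

Lemma thetaK x : cancel (theta x) (theta (- x)).
Proof. by move=> u; rewrite theta_opp lie_thetar /theta subrK. Qed.

Lemma thetaVK x : cancel (theta (- x)) (theta x).
Proof. by move=> u; rewrite -{1}[x]opprK thetaK. Qed.

Lemma nil_mul_affine x :
  nil_mul j x = fun y => x + y *m mx_of (theta (- x)).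
Proof.
apply/funext => y; rewrite (mx_ofE _ (theta_lin _)) theta_opp /nil_mul.
by rewrite addrA.
Qed.

Lemma jacobian_nil_mul x y : jacobian (nil_mul j x) y = mx_of (theta (- x)).
Proof. by rewrite nil_mul_affine jacobian_affine. Qed.

Lemma left_metricE x : left_metric j x = mx_of (theta x) *m (mx_of (theta x))^T.
Proof. by rewrite /left_metric jacobian_nil_mul opprK. Qed.

Lemma inner_left_metric x u v :
  inner (left_metric j) x u v = dot (theta x u) (theta x v).
Proof.
rewrite /inner left_metricE dotE -!(mx_ofE _ (theta_lin x)) trmx_mul.
by rewrite !mulmxA.
Qed.

Lemma left_metric_coef x a b : left_metric j x a b =
  dot (theta x (delta_mx 0 a)) (theta x (delta_mx 0 b)).
Proof. by rewrite left_metricE mx_of_gram. Qed.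

Lemma mx_theta_inv x : mx_of (theta x) *m mx_of (theta (- x)) = 1%:M.
Proof.
apply/row_matrixP => i; rewrite !rowE mulmxA mulmx1.
by rewrite (mx_ofE _ (theta_lin x)) (mx_ofE _ (theta_lin _)) thetaK.
Qed.

Lemma is_derive_left_metric x v a b :
  is_derive x v (fun y => left_metric j y a b)
   (- 2^-1 * (dot [[v, delta_mx 0 a]] (theta x (delta_mx 0 b))
              + dot (theta x (delta_mx 0 a)) [[v, delta_mx 0 b]])).
Proof.
have -> : (fun y => left_metric j y a b) =
    (fun y => dot (theta y (delta_mx 0 a)) (theta y (delta_mx 0 b))).
  by apply/funext => y; exact: left_metric_coef.
move: (delta_mx 0 a) (delta_mx 0 b) => ea eb.
apply: (@is_derive_quadratic _ _ _ _ _ _ (4^-1 * dot [[v, ea]] [[v, eb]])) => h.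
rewrite !theta_addl !dotDl !dotDr !dotNl !dotNr !dotZl !dotZr.
by field.
Qed.

Lemma partial_left_metric i a b x :
  partial i (fun y => left_metric j y a b) x =
  - 2^-1 * (dot [[delta_mx 0 i, delta_mx 0 a]] (theta x (delta_mx 0 b))
            + dot (theta x (delta_mx 0 a)) [[delta_mx 0 i, delta_mx 0 b]]).
Proof. by have [_ <-] := is_derive_left_metric x (delta_mx 0 i) a b. Qed.

(** The symmetric part of the Levi-Civita connection on left invariant fields:
    [D_p q = 1/2 [p, q] + sconn p q].  It is what remains in the Christoffel
    symbols, because coordinate fields commute. *)
Definition sconn p q : 'rV[R]_(m + r) :=
  row_mx (- 2^-1 *: (lsubmx p *m j (rsubmx q) + lsubmx q *m j (rsubmx p))) 0.

Lemma sconnC p q : sconn p q = sconn q p.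
Proof. by rewrite /sconn addrC. Qed.

Lemma sconn_linr p : linear (sconn p).
Proof.
apply: lin_row_mx; last by move=> a u w; rewrite scaler0 addr0.
by lin_tac j.
Qed.

Lemma sconn_linl q : linear (fun p => sconn p q).
Proof. by move=> a u v; rewrite -!(sconnC q) sconn_linr. Qed.

Lemma sconnDl p p' q : sconn (p + p') q = sconn p q + sconn p' q.
Proof. exact: linD (sconn_linl q) _ _. Qed.

Lemma sconnDr p q q' : sconn p (q + q') = sconn p q + sconn p q'.
Proof. exact: linD (sconn_linr p) _ _. Qed.

Lemma sconnZl a p q : sconn (a *: p) q = a *: sconn p q.
Proof. exact: linZ (sconn_linl q) _ _. Qed.

Lemma sconnZr a p q : sconn p (a *: q) = a *: sconn p q.
Proof. exact: linZ (sconn_linr p) _ _. Qed.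

Lemma sconn_lie u v u' v' : sconn [[u, v]] [[u', v']] = 0.
Proof.
by rewrite /sconn !row_mxKl !mul0mx addr0 scaler0 row_mx0.
Qed.

Lemma dot_sconn p q w :
  dot (sconn p q) w = - 2^-1 * (dot q [[p, w]] + dot p [[q, w]]).
Proof.
have H a b : dot a [[b, w]] = dot (rsubmx a) (vbracket j (lsubmx b) (lsubmx w)).
  by rewrite -{1}(hsubmxK a) dot_row_mx dot0r add0r.
rewrite !H -{1}(hsubmxK w) dot_row_mx dot0l addr0.
by rewrite dotZl dotDl !vbracketP.
Qed.

(** By Koszul's formula for coordinate fields, the inner product of the covariant
    derivative with the [l]-th coordinate field is half the bracketed sum of
    derivatives of the metric; [dot_sconn] recognizes it, and [invmx] then removes
    the pairing. *)
Lemma christoffelE a b k x : christoffel (left_metric j) a b k x =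
  theta (- x) (sconn (theta x (delta_mx 0 a)) (theta x (delta_mx 0 b))) 0 k.
Proof.
set K := sconn _ _; set T := mx_of (theta x); set T' := mx_of (theta (- x)).
have TT' : T *m T' = 1%:M := mx_theta_inv x.
have gU : left_metric j x \in unitmx.
  by rewrite left_metricE unitmx_mul unitmx_tr andbb (mulmx1_unit TT').1.
have Tg : T^T *m invmx (left_metric j x) = T'.
  apply: (canLR (mulmxK gU)); rewrite left_metricE mulmxA -/T.
  by rewrite (mulmx1C TT') mul1mx.
rewrite -(mx_ofE _ (theta_lin _)) -/T' -Tg mulmxA mxE /christoffel mulr_sumr.
apply: eq_bigr => l _; rewrite !partial_left_metric.
have -> : invmx (left_metric j x) k l = invmx (left_metric j x) l k.
  have gT : (left_metric j x)^T = left_metric j x.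
    by rewrite left_metricE trmx_mul trmxK.
  by rewrite -[in RHS]gT -trmx_inv mxE.
have -> : (K *m T^T) 0 l = dot K (theta x (delta_mx 0 l)).
  rewrite -(mx_ofE _ (theta_lin x)) -rowE mxE.
  by apply: eq_bigr => i _; rewrite !mxE.
rewrite /K dot_sconn !lie_thetal !lie_thetar.
rewrite (lieC (delta_mx 0 a) (delta_mx 0 b)) (lieC (delta_mx 0 a) (delta_mx 0 l)).
rewrite (lieC (delta_mx 0 b) (delta_mx 0 l)) !dotNl !dotNr.
rewrite (dotC [[delta_mx 0 a, delta_mx 0 l]]).
by field.
Qed.

(** The derivative of the Christoffel symbols in the direction [u], moved to the
    identity: the first term comes from the outer [theta (- y)], the others from
    the two arguments of [sconn]. *)
Definition dconn u v w : 'rV[R]_(m + r) :=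
  2^-1 *: ([[u, sconn v w]] - sconn [[u, v]] w - sconn v [[u, w]]).

Lemma partial_christoffel i a b k x :
  partial i (christoffel (left_metric j) a b k) x =
  theta (- x) (dconn (theta x (delta_mx 0 i)) (theta x (delta_mx 0 a))
                     (theta x (delta_mx 0 b))) 0 k.
Proof.
have -> : christoffel (left_metric j) a b k = fun y =>
    theta (- y) (sconn (theta y (delta_mx 0 a)) (theta y (delta_mx 0 b))) 0 k.
  by apply/funext => y; exact: christoffelE.
rewrite /partial; move: (delta_mx 0 i) (delta_mx 0 a) (delta_mx 0 b) => v ea eb.
set K := sconn (theta x ea) (theta x eb).
set L := sconn [[v, ea]] (theta x eb) + sconn (theta x ea) [[v, eb]].
have D : is_derive x v
    (fun y => theta (- y) (sconn (theta y ea) (theta y eb)) 0 k)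
    (theta (- x) (2^-1 *: ([[v, K]] - L)) 0 k).
  apply: (@is_derive_quadratic _ _ _ _ _ _ ((- 4^-1 *: [[v, L]]) 0 k)) => h.
  have SE : sconn (theta (h *: v + x) ea) (theta (h *: v + x) eb) =
      K - (h / 2) *: L.
    rewrite !theta_addl {}/K {}/L; move: (theta x ea) (theta x eb) => p q.
    rewrite -!(scaleNr (h / 2)) !sconnDl !sconnDr !sconnZl !sconnZr sconn_lie.
    move: (sconn p q) (sconn [[v, ea]] q) (sconn p [[v, eb]]) => s1 s2 s3.
    by apply/rowP => l; rewrite !mxE; ring.
  have {SE}-> : sconn (theta (h *: v + x) ea) (theta (h *: v + x) eb) =
      K + (- (h / 2)) *: L by rewrite SE scaleNr.
  rewrite -/K; clearbody K L; rewrite opprD -scalerN theta_addl lieNl.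
  rewrite !thetaD !thetaZ !lieDr !lieZr -(scaleN1r L) thetaD !thetaZ theta_lie.
  move: (theta (- x) K) (theta (- x) L) [[v, K]] [[v, L]] => s1 s2 s3 s4.
  by rewrite !mxE; field.
have [_ ->] := D.
rewrite /dconn !(lie_thetal x v) (lie_thetar x v ea) (lie_thetar x v eb).
by rewrite /L opprD addrA.
Qed.

Lemma curvE u v w : curv j u v w =
  dconn u v w - dconn v u w + sconn u (sconn v w) - sconn v (sconn u w).
Proof.
rewrite /dconn /sconn /curv /lie_bracket !row_mxKl !row_mxKr.
move: (lsubmx u) (lsubmx v) (lsubmx w) (rsubmx u) (rsubmx v) (rsubmx w).
move=> X Y V A B C.
rewrite !mul0mx !add0r !addr0 !j0 !mulmx0 !add0r.
rewrite !(linZ (vbracket_linr _ _)) (vbracketC _ X Y) -!scalemxAl !mulmxDl.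
have -> : j (- vbracket j X Y) = - j (vbracket j X Y) by exact: linearN.
rewrite mulmxN !(opp_row_mx, add_row_mx, scale_row_mx); congr row_mx.
  move: (Y *m j (vbracket j X V)) (X *m j (vbracket j Y V)) => a b.
  move: (V *m j (vbracket j X Y)) (V *m j B *m j A) (V *m j A *m j B) => c d e.
  move: (Y *m j C *m j A) (X *m j C *m j B) => f g.
  by apply/rowP => k; rewrite !mxE; field.
move: (vbracket j Y _) (vbracket j X _) => a b.
by apply/rowP => k; rewrite !mxE; field.
Qed.

(** Both sides are trilinear, so it is enough to compare them on coordinate
    vectors, where the products of Christoffel symbols compose to [sconn] inside
    [sconn].  The identity holds at every point [x], as it must by homogeneity. *)
Lemma curvature_left_metric x u v w :
  theta x (curvature (left_metric j) x u v w) =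
  curv j (theta x u) (theta x v) (theta x w).
Proof.
have coef a b c : \row_l curvature_coef (left_metric j) a b c l x =
    theta (- x) (curv j (theta x (delta_mx 0 a)) (theta x (delta_mx 0 b))
                        (theta x (delta_mx 0 c))).
  apply/rowP => l; rewrite mxE /curvature_coef !partial_christoffel sumrB.
  have sum_christoffel (p q s t : 'I_(m + r)) :
      \sum_i christoffel (left_metric j) p q i x
             * christoffel (left_metric j) s i t x =
      theta (- x) (sconn (theta x (delta_mx 0 s))
        (sconn (theta x (delta_mx 0 p)) (theta x (delta_mx 0 q)))) 0 t.
    (* The sum over [i] composes the two symbols: the inner one is the vector
       that is expanded in the coordinate basis. *)
    set f := fun z => theta (- x) (sconn (theta x (delta_mx 0 s)) (theta x z)).
    have lf : linear f.
      apply: (lin_comp (theta_lin _)).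
      exact: lin_comp (sconn_linr _) (theta_lin _).
    transitivity (f (theta (- x)
      (sconn (theta x (delta_mx 0 p)) (theta x (delta_mx 0 q)))) 0 t).
      rewrite -(mx_ofE _ lf) mxE; apply: eq_bigr => i _.
      by rewrite [mx_of f _ _]mxE !christoffelE.
    by rewrite /f thetaVK.
  rewrite !sum_christoffel curvE !thetaD.
  have tN z : theta (- x) (- z) = - theta (- x) z.
    by rewrite -(scaleN1r z) thetaZ scaleN1r.
  rewrite !tN.
  have E (p q s t : 'rV[R]_(m + r)) :
      p 0 l - q 0 l + (s 0 l - t 0 l) = (p - q + s - t) 0 l.
    by rewrite !mxE addrA.
  exact: E.
apply: (can_inj (thetaVK x)); rewrite thetaK.
pose f u v w := theta (- x) (curv j (theta x u) (theta x v) (theta x w)).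
rewrite -[RHS]/(f u v w) (@trilinear_expand _ _ _ f).
- apply/rowP => l; rewrite !mxE summxE; apply: eq_bigr => a _.
  rewrite summxE; apply: eq_bigr => b _; rewrite summxE; apply: eq_bigr => c _.
  by rewrite mxE /f -coef mxE.
- move=> v' w'; apply: (lin_comp (theta_lin _)).
  exact: (lin_comp (f := fun z => curv j z _ _)) (curv_lin1 _ _ _) (theta_lin _).
- move=> u' w'; apply: (lin_comp (theta_lin _)).
  exact: (lin_comp (f := fun z => curv j _ z _)) (curv_lin2 _ _ _) (theta_lin _).
- move=> u' v'; apply: (lin_comp (theta_lin _)).
  exact: lin_comp (curv_lin3 _ _ _) (theta_lin _).
Qed.

End LeviCivita.

(** * From curvature equivalence to equivalent maps *)

Section FromCurvature.
Variables (R : realType) (m r m' r' : nat).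
Variables (j : so_map R m r) (j' : so_map R m' r').
Hypotheses (m_gt0 : (0 < m)%N) (r_gt0 : (0 < r)%N) (m'_gt0 : (0 < m')%N)
  (r'_gt0 : (0 < r')%N).
Hypotheses (heis : heisenberg_map j) (heis' : heisenberg_map j').

Lemma curvature_isometry_so_equiv x x'
    (F : {linear 'rV[R]_(m + r) -> 'rV[R]_(m' + r')}) :
  bijective F ->
  (forall u v, inner (left_metric j') x' (F u) (F v) =
               inner (left_metric j) x u v) ->
  (forall u v w, F (curvature (left_metric j) x u v w) =
                 curvature (left_metric j') x' (F u) (F v) (F w)) ->
  so_equiv j j'.
Proof.
move=> [G FK GK] Fdot Fcurv.
pose f u := theta j' x' (F (theta j (- x) u)).
have lf : linear f.
  by apply: (lin_comp (theta_lin _ _)); exact: lin_comp (linE F) (theta_lin _ _).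
have fdot u v : dot (f u) (f v) = dot u v.
  rewrite /f -inner_left_metric Fdot inner_left_metric.
  by rewrite (thetaVK j x u) (thetaVK j x v).
have fcurv u v w : f (curv j u v w) = curv j' (f u) (f v) (f w).
  rewrite -{1}(thetaVK j x u) -{1}(thetaVK j x v) -{1}(thetaVK j x w).
  by rewrite -curvature_left_metric /f thetaK Fcurv curvature_left_metric.
have PPt : mx_of f *m (mx_of f)^T = 1%:M.
  apply/matrixP => a b.
  by rewrite mx_of_gram fdot dot_delta !mxE eqxx /= eq_sym.
apply: (curv_isometry_equiv m_gt0 r_gt0 m'_gt0 r'_gt0 heis heis' PPt).
  apply/row_matrixP => i; rewrite !rowE mulmx1 mulmxA.
  move: (delta_mx 0 i) => y.
  have -> : y = theta j x (G (theta j' (- x') y)) *m mx_of f.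
    by rewrite (mx_ofE _ lf) /f thetaK GK thetaVK.
  by rewrite -[_ *m mx_of f *m _]mulmxA PPt mulmx1.
by move=> u v w; rewrite !(mx_ofE _ lf).
Qed.

End FromCurvature.

(** * From equivalent maps to local isometries *)

Section Charts.
Variables (R : realType) (m r : nat) (j : so_map R m r).
Implicit Types x y z : 'rV[R]_(m + r).

Lemma nil_mulxV x : nil_mul j x (- x) = 0.
Proof. by rewrite -{1}[x]opprK; exact: nil_mulVx. Qed.

Lemma nil_mulx0 x : nil_mul j x 0 = x.
Proof. by rewrite /nil_mul (lin0 (lie_linr j x)) scaler0 !addr0. Qed.

Lemma lie_coord_dot u v k :
  lie_bracket j u v 0 k =
  dot u (v *m mx_of (fun w => \row_i lie_bracket j (delta_mx 0 i) w 0 k)).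
Proof.
rewrite mx_ofE; last first.
  by move=> a w w'; apply/rowP => i; rewrite mxE lie_linr !mxE.
rewrite -(mx_ofE _ (lie_linl j v)) mxE; apply: eq_bigr => i _.
by rewrite !mxE.
Qed.

Lemma nil_div_continuous_at x y :
  {for (x, y), continuous (fun p => nil_mul j p.1 (nil_inv p.2))}.
Proof.
have c1 : {for (x, y), continuous (@fst 'rV[R]_(m + r) 'rV[R]_(m + r))}.
  exact: cvg_fst.
have c2 : {for (x, y), continuous (@snd 'rV[R]_(m + r) 'rV[R]_(m + r))}.
  exact: cvg_snd.
apply: mx_continuous_at => i k; rewrite ord1.
set M := - 2^-1 *: mx_of (fun w => \row_i lie_bracket j (delta_mx 0 i) w 0 k).
have E : (fun p => nil_mul j p.1 (nil_inv p.2) 0 k) =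
   (fun p => dot p.1 (delta_mx 0 k)) +
   ((fun p => dot p.2 (- delta_mx 0 k)) + (fun p => dot p.1 (p.2 *m M))).
  apply/funext => p.
  have add_coord (u v w : 'rV[R]_(m + r)) :
      (u + v + 2^-1 *: w) 0 k = u 0 k + (v 0 k + 2^-1 * w 0 k).
    by rewrite !mxE addrA.
  rewrite [LHS]add_coord lie_coord_dot; congr (_ + (_ + _)).
  - by rewrite dot_delta.
  - by rewrite dotNr dot_delta mxE.
  - by rewrite /M /nil_inv mulNmx dotNr -scalemxAr dotZr mulrN mulNr.
rewrite E; apply: continuousD; last apply: continuousD.
- by apply: (dot_continuous_at c1); exact: cst_continuous.
- by apply: (dot_continuous_at c2); exact: cst_continuous.
- by apply: (dot_continuous_at c1); exact: mulmx_continuous_at c2.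
Qed.

Variable Gamma : nil_subgroup j.
Hypothesis discrete : forall a, subgroup_set Gamma a -> isolated Gamma a.

Lemma coset_proj_eq x y : coset_proj Gamma x = coset_proj Gamma y ->
  exists2 a, subgroup_set Gamma a & y = nil_mul j a x.
Proof. by move=> /(eqmodP (same_coset_rel Gamma)) /asboolP. Qed.

(** If two points near [x] lie in one coset, the element of [Gamma] relating them
    is close to [x x^-1 = 0], hence equal to the isolated point 0. *)
Lemma exists_chart x : exists2 U, chart_domain Gamma U & U x.
Proof.
have [_ [V V0 VG]] := discrete (subgroup1 Gamma).
have : nbhs (x, x) ((fun p => nil_mul j p.1 (nil_inv p.2)) @^-1` V).
  by apply: nil_div_continuous_at; rewrite /= nil_mulxV.
case=> -[A B] /= [nA nB] AB.
exists (interior (A `&` B)).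
  split; first exact: open_interior.
  move=> y z; rewrite !inE => /interior_subset[_ By] /interior_subset[Az _].
  move=> /coset_proj_eq[a Ga zE].
  have aE : a = nil_mul j z (nil_inv y).
    by rewrite zE -nil_mulA nil_mulxV nil_mulx0.
  have : (V `&` Gamma) a by split=> //; rewrite aE; exact: (AB (z, y)).
  by rewrite VG => /= a0; rewrite zE a0 nil_mul0x.
exact: filterI.
Qed.

Lemma chart_domainI (U W : set 'rV[R]_(m + r)) :
  chart_domain Gamma U -> open W -> chart_domain Gamma (U `&` W).
Proof.
move=> [oU iU] oW; split; first exact: openI.
by move=> y z; rewrite !inE => -[Uy _] [Uz _]; apply: iU; rewrite inE.
Qed.

End Charts.

Section LocalIsometry.
Variables (R : realType) (m r m' r' : nat).
Variables (j : so_map R m r) (j' : so_map R m' r').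
Variables (A : 'M[R]_(m, m')) (B : 'M[R]_(r, r')).
Hypotheses (AAt : A *m A^T = 1%:M) (AtA : A^T *m A = 1%:M).
Hypotheses (BBt : B *m B^T = 1%:M) (BtB : B^T *m B = 1%:M).
Hypothesis equiv : forall Z, A *m j' (Z *m B) = j Z *m A.

Let P : 'M[R]_(m + r, m' + r') := block_mx A 0 0 B.

Let PPt : P *m P^T = 1%:M.
Proof.
rewrite tr_block_mx mulmx_block !trmx0 !mulmx0 !mul0mx !addr0 !add0r AAt BBt.
by rewrite -scalar_mx_block.
Qed.

Let PtP : P^T *m P = 1%:M.
Proof.
rewrite tr_block_mx mulmx_block !trmx0 !mulmx0 !mul0mx !addr0 !add0r AtA BtB.
by rewrite -scalar_mx_block.
Qed.

Lemma lie_bracket_block u v :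
  lie_bracket j' (u *m P) (v *m P) = lie_bracket j u v *m P.
Proof.
rewrite /P -(hsubmxK u) -(hsubmxK v) !mul_row_block /lie_bracket !row_mxKl.
rewrite !mulmx0 !addr0 !mul0mx ?add0r ?mulmx0.
by rewrite (so_equiv_vbracket _ _ AAt BBt BtB equiv).
Qed.

(** The chain rule for the left translation by [- x], followed by the one taking
    its value to the identity. *)
Lemma theta_translate x y v :
  theta j (nil_mul j (- x) y) (theta j x v) = theta j y v.
Proof.
rewrite {1}/theta (lie_thetar j x _ v) /nil_mul.
rewrite !(linD (lie_linl j v)) (linZ (lie_linl j v)) lie_centerl lieNl.
rewrite /theta; move: (lie_bracket j x v) (lie_bracket j y v) => s t.
by apply/rowP => k; rewrite !mxE; ring.
Qed.

(** The map [y |-> (x^-1 y) P] is a composition of a left translation with an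
    isometric group isomorphism.  It is affine in these coordinates, hence smooth,
    and so is its inverse. *)
Lemma left_metric_isometry x (U0 : set 'rV[R]_(m + r))
    (U0' : set 'rV[R]_(m' + r')) :
  U0 x -> U0' 0 -> open U0 -> open U0' ->
  exists U U' f, [/\ open U, open U', U x &
    isometry_between (left_metric j) (U0 `&` U) (left_metric j') (U0' `&` U') f].
Proof.
move=> U0x U00 oU oU'.
pose f y := nil_mul j (- x) y *m P; pose h z := nil_mul j x (z *m P^T).
have fE : f = fun y => - x *m P + y *m (mx_of (theta j x) *m P).
  by apply/funext => y; rewrite /f nil_mul_affine mulmxDl opprK mulmxA.
have hE : h = fun z => x + z *m (P^T *m mx_of (theta j (- x))).
  by apply/funext => z; rewrite /h nil_mul_affine mulmxA.
have fK y : h (f y) = y.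
  rewrite /h /f -[_ *m P *m _]mulmxA PPt mulmx1 nil_mulA nil_mulxV.
  by rewrite nil_mul0x.
have hK z : f (h z) = z.
  rewrite /h /f nil_mulA.
  have -> : nil_mul j (- x) x = 0 by exact: nil_mulVx.
  by rewrite nil_mul0x -mulmxA PtP mulmx1.
have cf : continuous f by rewrite fE; exact: affine_continuous.
have ch : continuous h by rewrite hE; exact: affine_continuous.
exists (f @^-1` U0'), (h @^-1` U0), f; split.
- by move/continuousP: cf; exact.
- by move/continuousP: ch; exact.
- by rewrite /= /f (_ : nil_mul j (- x) x = 0) ?mul0mx //; exact: nil_mulVx.
split.
- by rewrite fE; exact: smooth_affine.
- exists h; split; first by rewrite hE; exact: smooth_affine.
    by move=> y [Uy Uy'] /=; rewrite fK.
  by move=> z [Uz Uz'] /=; rewrite hK.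
- move=> y u v _; rewrite !inner_left_metric {2 4}fE jacobian_affine.
  have H w : theta j' (f y) (w *m (mx_of (theta j x) *m P)) = theta j y w *m P.
    rewrite mulmxA (mx_ofE _ (theta_lin j x)) -(theta_translate x y w).
    move: (theta j x w) => t.
    by rewrite /theta lie_bracket_block mulmxDl mulNmx scalemxAl.
  by rewrite !H (dot_isometry PPt).
Qed.

End LocalIsometry.

Lemma so_equiv_locally_isometric_to (R : realType) (N N' : nilmanifold R) :
  so_equiv (nil_map N) (nil_map N') -> locally_isometric_to N N'.
Proof.
move=> [A [B [AAt AtA BBt BtB E]]] p.
pose x : 'rV[R]_(Defs.dimv N + dimz N) := repr p.
have xp : nil_proj N x = p by exact: reprK.
have [U0 cU U0x] := exists_chart (@nil_discrete R N) x.
have [U0' cU' U00] := exists_chart (@nil_discrete R N') 0.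
have [U [U' [f [oU oU' Ux fP]]]] :=
  left_metric_isometry AAt AtA BBt BtB E U0x U00 cU.1 cU'.1.
exists (U0 `&` U), (U0' `&` U'), f; split=> //.
- exact: chart_domainI.
- exact: chart_domainI.
- by exists x.
Qed.

Theorem proposition9 (R : realType) (N N' : nilmanifold R)
    (hN : heisenberg_type N) (hN' : heisenberg_type N') :
  ~ locally_isometric N N' -> ~ curvature_equivalent N N'.
Proof.
move=> not_iso ceq; apply: not_iso.
have [x [x' [_ _ [F [Fbij Fdot Fcurv]]]]] := ceq (nil_proj N 0) (nil_proj N' 0).
have E : so_equiv (nil_map N) (nil_map N').
  by apply: (curvature_isometry_so_equiv _ _ _ _ hN hN' Fbij Fdot Fcurv);
     rewrite ?Defs.dimv_gt0 ?dimz_gt0.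
by split; apply: so_equiv_locally_isometric_to => //; exact: so_equiv_sym.
Qed.
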